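(* For every fixed dimension $d\ge 1$ there is a constant $C_d>0$, depending only on $d$, such that the following holds. Let $S\subset\mathbb{R}^d$ be a finite set with $|S|\ge 2$ and let $r:S\to\mathbb{R}^+$ be a valid radii assignment with interference $i$. Then there exists a valid radii assignment $\bar r:S\to\mathbb{R}^+$ of interference at most $C_d\, i$ and with bounded radius $R_{\min}$, i.e. $\bar r(s)\le R_{\min}$ for all $s\in S$.
   Context: $d(\cdot,\cdot)$ is the Euclidean distance on $\mathbb{R}^d$. Elements of $S$ are called sensors. A radii assignment is a function $r:S\to\mathbb{R}^+$ (positive reals). It defines an undirected graph $G_r=(S,E)$ (symmetric model): for distinct $s,t\in S$, $st\in E$ if and only if $\min\{r(s),r(t)\}\ge d(s,t)$. The assignment $r$ is valid if $G_r$ is connected. The interference of a point $p\in\mathbb{R}^d$ is $I(p)=|\{s\in S: r(s)\ge d(s,p)\}|$, and the interference of $r$ is $\max_{p\in\mathbb{R}^d} I(p)$. $R_{\min}$ (depending on $S$) is the minimum value $R$ such that the uniform assignment $r\equiv R$ is valid; equivalently, the length of the longest edge of a Euclidean minimum spanning tree of $S$. *)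

(* Defs.v *)
From mathcomp Require Import all_boot all_order all_algebra finmap.
From mathcomp Require Import all_classical all_reals.

Set Implicit Arguments.
Unset Strict Implicit.
Unset Printing Implicit Defensive.

Import Order.TTheory GRing.Theory Num.Theory.
Local Open Scope classical_set_scope.
Local Open Scope ring_scope.

(* The library norm on ['rV[R]_d] is the sup norm, hence this definition. *)
Definition edist (R : realType) (d : nat) (x y : 'rV[R]_d) : R :=
  Num.sqrt (\sum_(k < d) (x ord0 k - y ord0 k) ^+ 2).

Section Sensors.
Variables (R : realType) (d : nat) (S : {fset 'rV[R]_d}).

Implicit Types (r : S -> R) (s t : S) (p : 'rV[R]_d).

Definition sensor_graph r : rel S :=
  fun s t => (s != t) && (edist (val s) (val t) <= Num.min (r s) (r t)).

Definition graph_connected (e : rel S) : Prop := forall s t, connect e s t.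

Definition radii_assignment r : Prop := forall s, 0 < r s.

Definition valid r : Prop :=
  radii_assignment r /\ graph_connected (sensor_graph r).

Definition interference_at r p : nat :=
  #|[set s : S | edist (val s) p <= r s]%SET|.

(* The values of [interference_at r] lie in {0, ..., #|S|}, so this is their
   maximum over all points of the space, not only over the sensors: see
   [interference_at_le] and [interference_attained]. *)
Definition interference r : nat :=
  \max_(k < #|{: S}|.+1 | `[< exists p, interference_at r p = k >]) k.

(* When S has at least two points this infimum is a minimum: see
   [Rmin_min]. *)
Definition Rmin : R := inf [set rho : R | valid (fun=> rho)].

Lemma interference_at_le r p : (interference_at r p <= interference r)%N.
Proof.
have lt : (interference_at r p < #|{: S}|.+1)%N by rewrite ltnS max_card.
apply: (@leq_bigmax_cond _ _ (fun k : 'I_(#|{: S}|.+1) => k : nat) (Ordinal lt)).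
by apply/asboolP; exists p.
Qed.

Lemma interference_attained r : exists p, interference_at r p = interference r.
Proof.
have lt : (interference_at r 0 < #|{: S}|.+1)%N by rewrite ltnS max_card.
have ne : (0 < #|[pred k : 'I_(#|{: S}|.+1) |
    `[< exists p, interference_at r p = k >]]|)%N.
  by apply/card_gt0P; exists (Ordinal lt); apply/asboolP; exists 0.
have [k /asboolP [p pk] ek] := eq_bigmax_cond (fun k => nat_of_ord k) ne.
by exists p; rewrite pk -ek.
Qed.

Lemma edist_ge0 p q : 0 <= edist p q.
Proof. exact: sqrtr_ge0. Qed.

Lemma edist_gt0 p q : p != q -> 0 < edist p q.
Proof.
move=> neq; rewrite sqrtr_gt0 lt_def sumr_ge0 ?andbT; last first.
  by move=> k _; rewrite sqr_ge0.
apply: contra neq; rewrite psumr_eq0; last by move=> k _; rewrite sqr_ge0.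
move=> /allP eq0; apply/eqP/rowP => k.
have := eq0 k (mem_index_enum _); rewrite /= sqrf_eq0 subr_eq0.
by move=> /eqP.
Qed.

Lemma valid_le_dist rho : (2 <= #|` S|)%N -> valid (fun=> rho) ->
  exists s t, edist (val s) (val t) <= rho /\
              valid (fun=> edist (val s) (val t)).
Proof.
rewrite cardfE => S2 [rho0 con].
pose P (u : S * S) := (u.1 != u.2) && (edist (val u.1) (val u.2) <= rho).
have [u0 Pu0] : exists u, P u.
  have /card_gt1P [a [b [_ _ ab]]] := S2.
  have /connectP [[|c q] /=] := con a b; first by move=> _ e; rewrite e eqxx in ab.
  by rewrite {1}/sensor_graph minxx => /andP [ac _] _; exists (a, c).
case: (@arg_maxP _ _ _ u0 P (fun u => edist (val u.1) (val u.2)) Pu0).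
move=> [s t] /andP [/= st le] mx.
exists s, t; split=> //; split=> [_|].
  by apply: edist_gt0; rewrite val_eqE.
move=> a b; have := con a b; apply: connect_sub => {a b} x y.
rewrite {1}/sensor_graph minxx => xy; apply: connect1.
rewrite /sensor_graph minxx; have /andP [-> _] /= := xy.
exact: (mx (x, y)).
Qed.

Lemma valid_uniform_exists : exists rho, valid (fun=> rho).
Proof.
pose D := \sum_(u : S * S) edist (val u.1) (val u.2).
have D0 : 0 <= D by apply: sumr_ge0 => u _; exact: edist_ge0.
exists (D + 1); split=> [_|s t]; first by rewrite ltr_wpDl.
have [->|st] := eqVneq s t; first exact: connect0.
apply: connect1; rewrite /sensor_graph st minxx /= ler_wpDr //.
rewrite /D (bigD1 (s, t)) //= lerDl.
by apply: sumr_ge0 => u _; exact: edist_ge0.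
Qed.

Lemma Rmin_min : (2 <= #|` S|)%N ->
  valid (fun=> Rmin) /\ forall rho, valid (fun=> rho) -> Rmin <= rho.
Proof.
move=> S2; pose P (u : S * S) := `[< valid (fun=> edist (val u.1) (val u.2)) >].
have [u0 Pu0] : exists u, P u.
  have [rho /(valid_le_dist S2) [s [t [_ v]]]] := valid_uniform_exists.
  by exists (s, t); apply/asboolP.
case: (@arg_minP _ _ _ u0 P (fun u => edist (val u.1) (val u.2)) Pu0).
move=> [s t] /asboolP /= v mn; set m := edist _ _ in v mn.
have lb rho : valid (fun=> rho) -> m <= rho.
  move=> /(valid_le_dist S2) [a [b [le /asboolP vab]]].
  by apply: le_trans le; exact: (mn (a, b)).
suff -> : Rmin = m by [].
apply/eqP; rewrite eq_le; apply/andP; split.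
  by apply: ge_inf => //; exists m => x /lb.
by apply: lb_le_inf; [exists m | move=> x /lb].
Qed.

End Sensors.

(* Main.v *)
Require Import Defs.
From mathcomp Require Import all_boot all_order all_algebra finmap.
From mathcomp Require Import all_classical all_reals.
From mathcomp Require Import zify lra.

(** Let [rho] be a valid uniform radius. Cut space into cubes of diameter at
    most [rho], and for every pair of cubes joined by a pair of sensors at
    distance at most [rho] select one such pair; a ball of radius [rho] contains
    only O_d(1) selected sensors. Give radius [rho] to the selected sensors and
    truncate all other radii at [rho], so that only O_d(1) interference is added.
    Sensors of radius [rho] in the same cube see each other, so the sensors of
    radius [rho] are all connected, as the uniform graph is. Finally, follow a
    path of the given graph from any sensor to a selected one: either all its
    edges survive the truncation, or the first one that does not starts at a
    sensor whose new radius is [rho]. *)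

Set Implicit Arguments.
Unset Strict Implicit.
Unset Printing Implicit Defensive.

Import Order.TTheory GRing.Theory Num.Theory.
Local Open Scope ring_scope.

(** * Euclidean distance and the grid of cubes *)

Section Edist.
Variables (R : realType) (d : nat).
Implicit Types x y : 'rV[R]_d.

Lemma edistC x y : edist x y = edist y x.
Proof.
by congr Num.sqrt; apply: eq_bigr => k _; rewrite -sqrrN opprB.
Qed.

Lemma edistxx x : edist x x = 0.
Proof.
rewrite /edist big1 ?sqrtr0 // => k _.
by rewrite subrr expr0n.
Qed.

Lemma coord_le_edist x y k : `|x ord0 k - y ord0 k| <= edist x y.
Proof.
rewrite -sqrtr_sqr ler_sqrt; last by apply: sumr_ge0 => i _; exact: sqr_ge0.
rewrite (bigD1 k) //= lerDl.
by apply: sumr_ge0 => i _; exact: sqr_ge0.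
Qed.

Lemma edist_le_coord x y (e : R) :
    0 <= e -> (forall k, `|x ord0 k - y ord0 k| <= e) ->
  edist x y <= d%:R * e.
Proof.
move=> e0 le; have de0 : 0 <= d%:R * e by rewrite mulr_ge0.
rewrite -[leRHS]ger0_norm // -sqrtr_sqr ler_sqrt ?sqr_ge0 //.
have: \sum_(k < d) (x ord0 k - y ord0 k) ^+ 2 <= \sum_(k < d) e ^+ 2.
  by apply: ler_sum => k _; rewrite -[leLHS]real_normK ?num_real // lerXn2r ?nnegrE.
move=> /le_trans; apply.
rewrite sumr_const card_ord -[e ^+ 2 *+ _]mulr_natl exprMn ler_wpM2r ?sqr_ge0 //.
by rewrite -natrX ler_nat; case: (d) => // n; rewrite leq_pmulr.
Qed.

(** The cubes have side [rho / d]: the crude bound [edist_le_coord] then gives diameter at most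
    [rho] without a square root of [d]. *)
Definition cell (rho : R) x : {ffun 'I_d -> int} :=
  [ffun k => Num.floor (x ord0 k * (d%:R / rho))].

(** Offsets in [0..2d] are recentred to [-d..d], so the neighbours of a cube are indexed by a finite
    type of size [(2d+1)^d]. *)
Definition shift (c : {ffun 'I_d -> int}) (o : {ffun 'I_d -> 'I_(d.*2.+1)}) :
    {ffun 'I_d -> int} :=
  [ffun k => c k + (o k)%:Z - d%:Z].

Variable rho : R.
Hypothesis rho0 : 0 < rho.

Lemma cell_diam x y : cell rho x = cell rho y -> edist x y <= rho.
Proof.
move=> eqc; have [d0|dgt0] := posnP d.
  rewrite /edist big1 ?sqrtr0 ?ltW // => k _.
  by exfalso; have := ltn_ord k; lia.
have dR : 0 < d%:R :> R by rewrite ltr0n.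
rewrite -[leRHS](divfK (lt0r_neq0 dR)) [leRHS]mulrC.
apply: edist_le_coord => [|k]; first by rewrite ltW ?divr_gt0.
have /ffunP/(_ k) := eqc; rewrite !ffunE => eqf.
have q0 : 0 < d%:R / rho by rewrite divr_gt0.
rewrite -(ler_pM2r q0).
have -> : rho / d%:R * (d%:R / rho) = 1.
  by rewrite mulrA divfK ?lt0r_neq0 // divff ?lt0r_neq0.
rewrite -[in leLHS](gtr0_norm q0) -normrM mulrBl.
have := floor_le (x ord0 k * (d%:R / rho)).
have := floor_le (y ord0 k * (d%:R / rho)).
have := floorD1_gt (x ord0 k * (d%:R / rho)).
have := floorD1_gt (y ord0 k * (d%:R / rho)).
rewrite eqf !intrD ler_norml => h1 h2 h3 h4.
apply/andP; split; lra.
Qed.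

Lemma cell_near x y :
  edist x y <= rho -> exists o, cell rho y = shift (cell rho x) o.
Proof.
move=> xy; have near k : `|cell rho y k - cell rho x k| <= d%:Z.
  have q0 : 0 <= d%:R / rho by rewrite divr_ge0 ?ler0n ?ltW.
  have : `|x ord0 k * (d%:R / rho) - y ord0 k * (d%:R / rho)| <= d%:R.
    rewrite -mulrBl normrM (ger0_norm q0) -[leRHS](divfK (lt0r_neq0 rho0)).
    rewrite [leRHS]mulrC ler_wpM2r //.
    exact: le_trans (coord_le_edist _ _ _) xy.
  rewrite ler_norml => /andP [h1 h2].
  have := floor_le (x ord0 k * (d%:R / rho)).
  have := floor_le (y ord0 k * (d%:R / rho)).
  have := floorD1_gt (x ord0 k * (d%:R / rho)).
  have := floorD1_gt (y ord0 k * (d%:R / rho)).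
  rewrite !ffunE !intrD => h3 h4 h5 h6.
  set a := Num.floor _ in h3 h5 *; set b := Num.floor _ in h4 h6 *.
  (* The scaled coordinates differ by at most [d]; integrality turns these strict bounds into a
     difference of floors of at most [d]. *)
  have ab : a < b + d%:Z + 1 by rewrite -(ltr_int R) !intrD; lra.
  have ba : b < a + d%:Z + 1 by rewrite -(ltr_int R) !intrD; lra.
  lia.
move: (cell rho x) (cell rho y) near => cx cy near.
exists [ffun k => inord (absz (cy k - cx k + d%:Z))].
apply/ffunP => k; rewrite !ffunE; have := near k; rewrite ler_norml => /andP [h1 h2].
have h0 : 0 <= cy k - cx k + d%:Z by lia.
rewrite inordK; move: (cx k) (cy k) h0 h1 h2 => a b *; lia.
Qed.

End Edist.

(** * Selected sensors and the truncated assignment *)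

Section Backbone.
Variables (R : realType) (d : nat) (S : {fset 'rV[R]_d}) (rho : R) (r : S -> R).
Hypothesis rho_valid : valid (fun _ : S => rho).
Hypothesis r_valid : valid r.

Implicit Types s t x y : S.

Lemma sensor_graph_sym (q : S -> R) : symmetric (sensor_graph q).
Proof. by move=> s t; rewrite /sensor_graph eq_sym edistC minC. Qed.

Definition scell s := cell rho (val s).

(* Pairs with [s = t] are allowed, so every occupied cell is linked to itself. *)
Definition link (c c' : {ffun 'I_d -> int}) : option (S * S) :=
  [pick u : S * S | [&& scell u.1 == c, scell u.2 == c'
                      & edist (val u.1) (val u.2) <= rho]].

Definition linked (b : bool) c c' : option S :=
  omap (fun u : S * S => if b then u.1 else u.2) (link c c').

(** Pairs of cubes are named through pairs of sensors lying in them, which makes the quantifier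
    finite. *)
Definition selected s : bool :=
  [exists u : S * S,
    (linked true (scell u.1) (scell u.2) == Some s) ||
    (linked false (scell u.1) (scell u.2) == Some s)].

Definition reduced s : R := if selected s then rho else Num.min (r s) rho.

Lemma link_someP c c' x y : link c c' = Some (x, y) ->
  [/\ scell x = c, scell y = c' & edist (val x) (val y) <= rho].
Proof.
rewrite /link; case: pickP => // u /and3P [/eqP h1 /eqP h2 h3] [eu].
by subst u.
Qed.

(** Lifts an edge of the uniform graph to selected sensors in the same cubes; for [s = t] it yields
    a selected sensor in every occupied cube. *)
Lemma linkP s t : edist (val s) (val t) <= rho ->
  exists x y, [/\ selected x, selected y, scell x = scell s, scell y = scell t
                & edist (val x) (val y) <= rho].
Proof.
move=> st; case E: (link (scell s) (scell t)) => [[x y]|]; last first.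
  move: E; rewrite /link; case: pickP => // /(_ (s, t)) /=.
  by rewrite !eqxx st.
have [cx cy xy] := link_someP E; exists x, y.
by split=> //; apply/existsP; exists (s, t); rewrite /linked /= E /= eqxx ?orbT.
Qed.

(** A selected sensor near [p] is determined by the offset from the cube of [p] to its own, the
    offset from there to the cube of its partner, and which end of the link it is. *)
Lemma card_selected_ball (p : 'rV[R]_d) :
  (#|[set s : S | selected s && (edist (val s) p <= rho)%R]|
    <= 2 * (d.*2.+1 ^ d) ^ 2)%N.
Proof.
pose O := {ffun 'I_d -> 'I_(d.*2.+1)}.
pose g (u : bool * (O * O)) : option S :=
  let c := shift (cell rho p) u.2.1 in
  if u.1 then linked true c (shift c u.2.2) else linked false (shift c u.2.2) c.
have -> : (2 * (d.*2.+1 ^ d) ^ 2)%N = #|{: bool * (O * O)}|.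
  by rewrite !card_prod card_bool card_ffun !card_ord mulnn.
apply: leq_trans (leq_imset_card g _).
rewrite -(card_imset _ (@Some_inj _)); apply/subset_leq_card/fintype.subsetP => _ /imsetP [s + ->].
have rho0 : 0 < rho by have [/(_ s)] := rho_valid.
rewrite inE edistC => /andP [sel ps].
have [o1 e1] := cell_near rho0 ps.
have [[a b] /=] := existsP sel; rewrite /linked.
case E: (link _ _) => [[x y]|] //=; have [cx cy xy] := link_someP E.
case/orP => /eqP [es]; subst s.
  have [o2 e2] := cell_near rho0 xy.
  apply/imsetP; exists (true, (o1, o2)) => //.
  by rewrite /g /linked /= -e1 -e2 -/(scell x) -/(scell y) cx cy E.
(* Now the sensor near [p] is the second end [y], so the second offset leads from [y] back to
   [x]. *)
rewrite edistC in xy; have [o2 e2] := cell_near rho0 xy.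
apply/imsetP; exists (false, (o1, o2)) => //.
by rewrite /g /linked /= -e1 -e2 -/(scell x) -/(scell y) cx cy E.
Qed.

Lemma rho_le_reduced s : (rho <= reduced s) = selected s || (rho <= r s).
Proof. by rewrite /reduced; case: ifP; rewrite ?lexx // le_min lexx andbT. Qed.

Lemma reduced_valid : valid reduced.
Proof.
have [rhoS rho_con] := rho_valid; have [r0 r_con] := r_valid.
have rho0 (x : S) : 0 < rho by exact: (rhoS x).
have selR x : selected x -> rho <= reduced x by rewrite rho_le_reduced => ->.
split=> [s|].
  by rewrite /reduced; case: ifP => _; rewrite ?lt_min ?r0 ?(rho0 s).
have edge x y : rho <= reduced x -> rho <= reduced y ->
    edist (val x) (val y) <= rho -> connect (sensor_graph reduced) x y.
  move=> hx hy xy; have [->|ne] := eqVneq x y; first exact: connect0.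
  apply: connect1; rewrite /sensor_graph ne le_min.
  by rewrite (le_trans xy hx) (le_trans xy hy).
have same x y : rho <= reduced x -> rho <= reduced y ->
    scell x = scell y -> connect (sensor_graph reduced) x y.
  move=> hx hy xy; apply: edge => //; exact: (cell_diam (rho0 x) xy).
(* Only the cubes of [s] and [t] matter, so the induction may replace each vertex of the path by a
   selected sensor in its cube. *)
have hubs s t x y : connect (sensor_graph (fun _ : S => rho)) s t ->
    rho <= reduced x -> rho <= reduced y ->
    scell x = scell s -> scell y = scell t -> connect (sensor_graph reduced) x y.
  move=> /connectP [q pq ->] {t} hx hy.
  elim: q s x pq hx => [|t q IH] s x /=; first by move=> _ hx xs yt; apply: same; rewrite // xs yt.
  move=> /andP [+ tq] hx xs yt; rewrite /sensor_graph minxx => /andP [_ st].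
  have [a [b [sa sb ca cb ab]]] := linkP st.
  have xa : scell x = scell a by rewrite xs.
  apply: connect_trans (same x a hx (selR _ sa) xa) _.
  apply: connect_trans (edge a b (selR _ sa) (selR _ sb) ab) _.
  exact: IH tq (selR _ sb) cb yt.
have to_hub s : exists2 x, rho <= reduced x & connect (sensor_graph reduced) s x.
  have [|x [_ [sx _ _ _ _]]] := @linkP s s; first by rewrite edistxx ltW ?(rho0 s).
  have /connectP [q] := r_con s x; elim: q s => [|t q IH] s /=.
    by move=> _ xs; exists s; [rewrite -xs selR | exact: connect0].
  move=> /andP [/andP [ne]]; rewrite le_min => /andP [hs ht] tq xl.
  (* An edge longer than [rho] forces [r s] above [rho], so [s] itself is a hub; a shorter edge
     survives the truncation. *)
  have [le|/ltW gt] := leP (edist (val s) (val t)) rho; last first.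
    exists s; last exact: connect0.
    by rewrite rho_le_reduced (le_trans gt hs) orbT.
  have [y hy ty] := IH _ tq xl; exists y => //; apply: connect_trans ty.
  apply: connect1; rewrite /sensor_graph ne /= le_min /reduced.
  by case: ifP => _; case: ifP => _; rewrite ?le_min ?le ?hs ?ht.
move=> s t; have [x hx sx] := to_hub s; have [y hy ty] := to_hub t.
apply: connect_trans sx _.
apply: connect_trans (hubs x y x y (rho_con x y) hx hy erefl erefl) _.
by rewrite (sym_connect_sym (@sensor_graph_sym _)).
Qed.

Lemma reduced_le s : reduced s <= rho.
Proof. by rewrite /reduced; case: ifP; rewrite // ge_min lexx orbT. Qed.

(** A sensor reaching [p] under [reduced] either reaches it under [r] or is selected and within
    [rho] of [p]. *)
Lemma interference_reduced :
  (interference reduced <= interference r + 2 * (d.*2.+1 ^ d) ^ 2)%N.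
Proof.
have [p <-] := interference_attained reduced.
apply: leq_trans (leq_add (interference_at_le r p) (card_selected_ball p)).
apply: leq_trans (leq_card_setU _ _).
apply/subset_leq_card/fintype.subsetP => s; rewrite !inE /reduced.
case: ifP => _ /=; first by move=> ->; rewrite orbT.
by rewrite le_min => /andP [->].
Qed.

Lemma interference_gt0 s : (0 < interference r)%N.
Proof.
apply: leq_trans (interference_at_le r (val s)).
apply/card_gt0P; exists s; rewrite inE edistxx.
by have [/(_ s) /ltW] := r_valid.
Qed.

End Backbone.

Theorem theorem1 (R : realType) (d : nat) (hd : (1 <= d)%N) :
  exists C : R, 0 < C /\
    forall (S : {fset 'rV[R]_d}) (hS : (2 <= #|` S|)%N)
           (r : S -> R) (hr : valid r),
      exists rbar : S -> R,
        [/\ valid rbar,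
            (interference rbar)%:R <= C * (interference r)%:R
          & forall s : S, rbar s <= Rmin S].
Proof.
exists (1 + 2 * (d.*2.+1 ^ d) ^ 2)%:R; split=> [|S hS r hr].
  by rewrite ltr0n.
have [Rv _] := Rmin_min hS.
exists (reduced (Rmin S) r); split; [exact: reduced_valid | | exact: reduced_le].
have [s _] : exists s, s \in {: S}.
  by apply/card_gt0P; rewrite -cardfE ltnW.
rewrite -natrM ler_nat mulnDl mul1n.
apply: leq_trans (interference_reduced _ Rv) _.
(* Since [interference r] is at least 1, the additive term is absorbed into the factor. *)
by rewrite leq_add2l leq_pmulr // (interference_gt0 hr s).
Qed.
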